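(* Let $0<\varepsilon<1/16$, let $G=(V,E,w)$ be a graph with positive edge weights, let $M^\ast$ be a maximum weight matching of $G$, and let $M$ be a matching with $w(M) < (1-\varepsilon)\,w(M^\ast) \le w(M^\ast)/(1+\varepsilon)$. Then there exists a collection $\mathcal{C}$ of vertex-disjoint augmentations (with respect to $M$) such that: (i) each $C\in\mathcal{C}$ belongs to the augmentation class of $(1+\varepsilon^4)^i$ for at least one $i\in\mathbb{N}$ with $(1+\varepsilon^4)^i\le w(C)$; and (ii) $\sum_{C\in\mathcal{C}} \mathrm{gain}(C) \ge \varepsilon^2 w(M^\ast)/200$.
   Context: For a set of edges $F$, $w(F)=\sum_{e\in F}w(e)$. An alternating path (resp. cycle) w.r.t. $M$ is a path (resp. cycle) whose edges alternate between $M$ and $E\setminus M$ (a path may start with either kind of edge). An augmentation is an alternating path or alternating cycle. For an augmentation $C$, its matching neighborhood $N_M(C)$ is the set of all edges of $M$ incident to vertices of $C$ (including those on $C$). Applying $C$ means removing $N_M(C)$ from $M$ and adding $C\setminus M$; $\mathrm{gain}(C)$ is the resulting increase of the matching weight, i.e. $w(C\setminus M)-w(N_M(C))$. Augmentation class of a weight $W>0$: the set of all augmentations $C$ (w.r.t. $M$) such that (1) every edge of $C$ has weight between $\varepsilon^{12}W$ and $2W$; (2) $\mathrm{gain}(C)\le 2W$; (3) if the weight of each edge of $N_M(C)$ is rounded up, and the weight of each edge of $C\setminus N_M(C)$ is rounded down, to the nearest multiple of $\varepsilon^{12}W$, then the gain of $C$ computed with these rounded weights is at least $\varepsilon^{12}W$;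 (4) $C$ has at most $64/\varepsilon^2+1$ vertices.
   Formalization: In (i) the exponent i is an integer, required to be natural only when w(C) ≥ 1; with i∈ℕ throughout, the claim fails, e.g. for a single edge of weight 1/10 and M empty, since then no natural i satisfies (1+ε^4)^i ≤ w(C). *)

(* Defs.v *)
From mathcomp Require Import all_boot all_order all_algebra.
From mathcomp Require Import reals.

Set Implicit Arguments.
Unset Strict Implicit.
Unset Printing Implicit Defensive.

Import Order.TTheory GRing.Theory Num.Theory.
Local Open Scope ring_scope.

(* An edge of a graph on V is a two-element set of vertices, and a subgraph
   without isolated vertices (a matching, a path, a cycle) is identified with
   its set of edges; its vertex set is then [cover C]. *)

Definition simple_graph (V : finType) (E : {set {set V}}) : Prop :=
  forall e, e \in E -> #|e| = 2.

Definition weight (R : realType) (V : finType) (w : {set V} -> R)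
    (F : {set {set V}}) : R :=
  \sum_(e in F) w e.

Definition matching (V : finType) (E M : {set {set V}}) : bool :=
  (M \subset E) && trivIset M.

Definition max_weight_matching (R : realType) (V : finType)
    (E : {set {set V}}) (w : {set V} -> R) (M : {set {set V}}) : Prop :=
  matching E M /\
  (forall M' : {set {set V}}, matching E M' -> weight w M' <= weight w M).

Definition path_edges (V : finType) (p : seq V) : seq {set V} :=
  if p is x :: q then pairmap (fun u v => [set u; v]) x q else [::].

Definition cycle_edges (V : finType) (p : seq V) : seq {set V} :=
  if p is x :: q then pairmap (fun u v => [set u; v]) x (rcons q x) else [::].

Definition alternates (V : finType) (M : {set {set V}}) : rel {set V} :=
  [rel e f | (e \in M) != (f \in M)].

(* Paths have at least one edge: a single vertex is not determined by its
   (empty) edge set. Its gain would not be positive under nonnegative weights. *)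
Definition alternating_path (V : finType) (E M C : {set {set V}}) : Prop :=
  exists p : seq V,
    [/\ (1 < size p)%N, uniq p, C = [set e in path_edges p], C \subset E
      & sorted (alternates M) (path_edges p)].

Definition alternating_cycle (V : finType) (E M C : {set {set V}}) : Prop :=
  exists p : seq V,
    [/\ (2 < size p)%N, uniq p, C = [set e in cycle_edges p], C \subset E
      & cycle (alternates M) (cycle_edges p)].

Definition augmentation (V : finType) (E M C : {set {set V}}) : Prop :=
  alternating_path E M C \/ alternating_cycle E M C.

Definition matching_nbhd (V : finType) (M C : {set {set V}}) : {set {set V}} :=
  [set e in M | ~~ [disjoint e & cover C]].

Definition gain (R : realType) (V : finType) (w : {set V} -> R)
    (M C : {set {set V}}) : R :=
  weight w (C :\: M) - weight w (matching_nbhd M C).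

Definition round_up (R : realType) (d x : R) : R := (Num.ceil (x / d))%:~R * d.

Definition round_down (R : realType) (d x : R) : R :=
  (Num.floor (x / d))%:~R * d.

Definition rounded_weight (R : realType) (V : finType) (w : {set V} -> R)
    (M C : {set {set V}}) (d : R) : {set V} -> R :=
  fun e => if e \in matching_nbhd M C then round_up d (w e)
           else round_down d (w e).

Definition augmentation_class (R : realType) (V : finType) (E : {set {set V}})
    (w : {set V} -> R) (M : {set {set V}}) (eps W : R) (C : {set {set V}}) :
    Prop :=
  let d := eps ^+ 12 * W in
  [/\ augmentation E M C,
      forall e, e \in C -> d <= w e <= 2 * W,
      gain w M C <= 2 * W,
      d <= gain (rounded_weight w M C d) M C
    & #|cover C|%:R <= 64 / eps ^+ 2 + 1].

(* Main.v *)
(* Let mu(v) be the weight of the edge of M \ Mopt at v, and charge a path q of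
   the symmetric difference with mu(q), the sum of mu over its vertices. Every
   M-edge on q is charged twice and every M-edge leaving q once, so gain(q) is
   at least w(q) - mu(q). This bound is additive: cutting q at an edge e costs
   exactly w(e), whether or not e is in M.

   The symmetric difference splits into paths and cycles. Each is cut into
   paths with at most 2L vertices, where L is about 32/eps^2, by cutting at
   edges cheap relative to disjoint runs of L edges (total cost w/L), and then
   at all edges lighter than eps^12 times the weight of their run. A cycle is
   first opened at a cheap edge if it is long or has a light edge; otherwise it
   is opened at an edge of M, which does not change its gain, so only paths are
   needed. Since w(M) < (1 - eps) w(Mopt), most of the excess eps w(Mopt)
   survives, even after dropping the pieces whose gain is below eps^8 w(C). A
   remaining piece C is in the class of the largest power W <= w(C): rounding
   changes its gain by at most about 128 eps^10 W, less than eps^8 W. *)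

Require Import Defs.
From mathcomp Require Import all_boot all_order all_algebra.
From mathcomp Require Import reals.
From mathcomp Require Import zify ring lra.

Set Implicit Arguments.
Unset Strict Implicit.
Unset Printing Implicit Defensive.

Import Order.TTheory GRing.Theory Num.Theory.
Local Open Scope ring_scope.

(** * Edge sequences of vertex lists, opening cycles, disjoint families of lists *)

Section PathEdges.
Variable V : finType.
Implicit Types (p q : seq V) (e : {set V}).

Lemma path_edges_cat x p y q :
  path_edges (x :: p ++ y :: q) =
  path_edges (x :: p) ++ [set last x p; y] :: path_edges (y :: q).
Proof. by rewrite /= pairmap_cat. Qed.

Lemma cycle_edges_cons x p : cycle_edges (x :: p) = path_edges (x :: rcons p x).
Proof. by []. Qed.

Lemma cycle_edges_rcons x p :
  cycle_edges (x :: p) = rcons (path_edges (x :: p)) [set last x p; x].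
Proof. by rewrite cycle_edges_cons -!cats1 path_edges_cat. Qed.

Lemma path_edgesP e p :
  reflect (exists a b x y, p = a ++ x :: y :: b /\ e = [set x; y])
          (e \in path_edges p).
Proof.
apply: (iffP idP) => [|[a [b [x [y [-> ->]]]]]]; last first.
  case: a => [|z a]; first by rewrite /= mem_head.
  rewrite -cat_rcons -/(cat [:: z] _) cat_cons.
  by rewrite path_edges_cat last_rcons mem_cat mem_head orbT.
case: p => // x p; elim: p x => [|y p IH] x //=.
rewrite inE => /predU1P[->|/IH[a [b [u [v [-> ->]]]]]].
  by exists [::], p, x, y.
by exists (x :: a), b, u, v.
Qed.

Lemma path_cycle_edges p : {subset path_edges p <= cycle_edges p}.
Proof.
by case: p => // x p e ep; rewrite cycle_edges_rcons mem_rcons inE ep orbT.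
Qed.

Lemma path_edge_sub e p : e \in path_edges p -> e \subset p.
Proof.
case/path_edgesP=> a [b [x [y [-> ->]]]]; apply/subsetP=> z.
by rewrite !inE mem_cat !inE => /orP[]/eqP->; rewrite eqxx !orbT.
Qed.

Lemma cycle_edge_sub e p : e \in cycle_edges p -> e \subset p.
Proof.
case: p => // x p; rewrite cycle_edges_cons => /path_edge_sub/subsetP ep.
by apply/subsetP => y /ep; rewrite !inE mem_rcons inE orbA orbb.
Qed.

Lemma uniq_path_edges p : uniq p -> uniq (path_edges p).
Proof.
case: p => // x p; elim: p x => [|y p IH] x //= /andP[xp up].
rewrite IH // andbT; apply/negP=> /(@path_edge_sub _ (y :: p)) /subsetP/(_ x).
by rewrite set21 => /(_ isT); apply/negP.
Qed.

Lemma path_edges_rev p : {subset path_edges (rev p) <= path_edges p}.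
Proof.
move=> e /path_edgesP[a [b [x [y [E ->]]]]]; apply/path_edgesP.
exists (rev b), (rev a), y, x; split; last by rewrite setUC.
by rewrite -(revK p) E rev_cat !rev_cons -!cats1 -!catA.
Qed.

Lemma path_edges_flatten q (qs : seq (seq V)) : q \in qs ->
  {subset path_edges q <= path_edges (flatten qs)}.
Proof.
case/splitPr=> s1 s2 e /path_edgesP[a [b [x [y [-> ->]]]]]; apply/path_edgesP.
exists (flatten s1 ++ a), (b ++ flatten s2), x, y; split=> //.
by rewrite flatten_cat /= -!catA.
Qed.

Lemma cover_path_edges p :
  (1 < size p)%N -> cover [set e in path_edges p] = [set x in p].
Proof.
move=> sp; apply/eqP; rewrite eqEsubset; apply/andP; split.
  apply/bigcupsP=> e; rewrite inE => /path_edge_sub /subsetP ep.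
  by apply/subsetP=> x /ep; rewrite inE.
apply/subsetP=> z; rewrite inE => zp; apply/bigcupP.
suff [e ee ze] : exists2 e, e \in path_edges p & z \in e.
  by exists e; rewrite // inE.
case/splitPr: zp sp => [[|x a] [|y b]]; rewrite //= ?addn0.
- by exists [set z; y]; rewrite ?mem_head ?set21.
- move=> _; exists [set last x a; z]; last by rewrite set22.
  by rewrite -[pairmap _ _ _]/(path_edges (x :: a ++ [:: z])) path_edges_cat mem_cat mem_head orbT.
move=> _; exists [set last x a; z]; last by rewrite set22.
by rewrite -[pairmap _ _ _]/(path_edges (x :: a ++ z :: y :: b)) path_edges_cat mem_cat mem_head orbT.
Qed.

(** Start at [y], run to the end of the list, wrap around through [x] and stop at [last x c]: only
    the step from [last x c] to [y] is lost. *)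
Lemma open_closed_walk x p c y d : rcons p x = c ++ y :: d ->
  exists q, [/\ perm_eq q (x :: p),
    {subset path_edges q <= cycle_edges (x :: p)}
    & {subset cycle_edges (x :: p) <= [set last x c; y] :: path_edges q}].
Proof.
case/lastP: d => [|d z].
  rewrite cats1 => /rcons_inj[-> ->]; exists (y :: c); split=> //.
  - by move=> e; rewrite cycle_edges_rcons mem_rcons inE => ->; rewrite orbT.
  by move=> e; rewrite cycle_edges_rcons mem_rcons.
rewrite -rcons_cons -rcons_cat => /rcons_inj[-> _].
exists (y :: d ++ x :: c); rewrite cycle_edges_rcons; split.
- by rewrite -cat_cons perm_catC.
- move=> e; rewrite !path_edges_cat last_cat /= mem_rcons !inE !mem_cat !inE.
  by case/or3P=> ->; rewrite ?orbT.
move=> e; rewrite !path_edges_cat last_cat /= mem_rcons !inE !mem_cat !inE.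
by case/or4P=> ->; rewrite ?orbT.
Qed.

Lemma open_cycle p e : e \in cycle_edges p ->
  exists q, [/\ perm_eq q p, {subset path_edges q <= cycle_edges p}
    & {subset cycle_edges p <= e :: path_edges q}].
Proof.
case: p => // x p; rewrite [in X in X -> _]cycle_edges_cons.
case/path_edgesP=> a [b [u [v [E ->]]]].
case: a E => [[<- E]|z a [_ E]]; first exact: (@open_closed_walk x p [::] v b).
have := @open_closed_walk x p (rcons a u) v b.
by rewrite cat_rcons last_rcons; apply.
Qed.

Lemma mem_uniq_flatten (ps : seq (seq V)) p q x : uniq (flatten ps) ->
  p \in ps -> q \in ps -> x \in p -> x \in q -> p = q.
Proof.
elim: ps => //= r ps IH; rewrite cat_uniq => /and3P[_ /hasPn dis /IH{}IH].
rewrite !inE => /predU1P[->|pps] /predU1P[->|qps] // xp xq; last exact: IH.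
- by have /dis/negP[] : x \in flatten ps by apply/flattenP; exists q.
by have /dis/negP[] : x \in flatten ps by apply/flattenP; exists p.
Qed.

Lemma uniq_mem_flatten (ps : seq (seq V)) p :
  uniq (flatten ps) -> p \in ps -> uniq p.
Proof.
move=> + pps; case/splitPr: pps => s1 s2.
by rewrite flatten_cat /= !cat_uniq => /and3P[_ _ /and3P[]].
Qed.

Lemma uniq_of_flatten (ps : seq (seq V)) :
  uniq (flatten ps) -> [::] \notin ps -> uniq ps.
Proof.
elim: ps => //= p ps IH; rewrite cat_uniq inE negb_or eq_sym.
case/and3P=> _ /hasPn dis ups /andP[p0 /(IH ups)->]; rewrite andbT.
apply/negP => pps; case: p p0 pps dis => // x p _ pps dis.
have /dis/negP[] : x \in flatten ps.
  by apply/flattenP; exists (x :: p); rewrite ?mem_head.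
exact: mem_head.
Qed.

End PathEdges.

(** * Partition of a graph of maximum degree two into paths and cycles *)

Section Decomposition.
Variables (V : finType) (F : {set {set V}}).
Hypothesis F_card2 : forall e, e \in F -> #|e| = 2.
Hypothesis F_degree2 : forall u e f g, e \in F -> f \in F -> g \in F ->
  u \in e -> u \in f -> u \in g -> [|| e == f, f == g | g == e].

(** An inner vertex already lies on two path edges, distinct because the vertices are; a third edge
    would break the degree bound. *)
Lemma path_endpoint x p e u : uniq (x :: p) ->
  {subset path_edges (x :: p) <= F} -> e \in F -> e \notin path_edges (x :: p) ->
  u \in e -> u \in x :: p -> u = x \/ u = last x p.
Proof.
move=> up pF eF enp ue; rewrite inE => /predU1P[->|us]; first by left.
case/splitPr: us up pF enp => a [|y b] up pF enp; first by right; rewrite last_cat.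
have e1 : [set last x a; u] \in path_edges (x :: a ++ u :: y :: b).
  by rewrite path_edges_cat mem_cat mem_head orbT.
have e2 : [set u; y] \in path_edges (x :: a ++ u :: y :: b).
  by rewrite path_edges_cat mem_cat !inE eqxx !orbT.
have := F_degree2 eF (pF _ e1) (pF _ e2) ue (set22 _ _) (set21 _ _).
case/or3P => /eqP E; first by rewrite E e1 in enp.
  have : last x a \in [set u; y] by rewrite -E set21.
  move: up; rewrite -cat_cons cat_uniq => /and3P[_ /hasPn up _].
  move=> la; have /up/negP[] : last x a \in [:: u, y & b].
    by move: la; rewrite !inE => /orP[]->; rewrite ?orbT.
  exact: mem_last.
by rewrite -E e2 in enp.
Qed.

Lemma orient_path x p e u : uniq (x :: p) ->
  {subset path_edges (x :: p) <= F} -> e \in F -> e \notin path_edges (x :: p) ->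
  u \in e -> u \in x :: p ->
  exists y q, [/\ perm_eq (y :: q) (x :: p), {subset path_edges (y :: q) <= F}
    & u = last y q].
Proof.
move=> up pF eF enp ue /(path_endpoint up pF eF enp ue) [->|->]; last first.
  by exists x, p.
have : {subset path_edges (rev (x :: p)) <= F} by move=> f /path_edges_rev/pF.
have : last x (rev (x :: p)) = x by rewrite rev_cons last_rcons.
have : perm_eq (rev (x :: p)) (x :: p) by rewrite perm_rev.
case: (rev _) => [E|z q] //; first by have := perm_size E.
by move=> pe /= le sF; exists z, q.
Qed.

(* Start from singletons and merge two paths along an edge of F that is not
   covered: by the degree bound its ends are ends of two different paths. *)
Lemma path_decomposition : exists ps : seq (seq V),
  [/\ perm_eq (flatten ps) (enum V),
      forall p, p \in ps -> {subset path_edges p <= F}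
    & forall e, e \in F -> exists2 p, p \in ps & e \in cycle_edges p].
Proof.
have : exists ps : seq (seq V), perm_eq (flatten ps) (enum V) /\
      forall p, p \in ps -> {subset path_edges p <= F}.
  exists [seq [:: x] | x <- enum V]; split; first by rewrite flatten_seq1.
  by move=> p /mapP[x _ ->].
case=> ps; have [n] := ubnP (size ps); elim: n ps => // n IH ps.
rewrite ltnS => size_ps [ps_V ps_F].
(* Coverage refers to [cycle_edges]: the edge joining the two ends of a path counts as covered,
   which is how cycles arise. *)
case: (boolP [forall (e | e \in F), has (fun p => e \in cycle_edges p) ps]).
  by move/forall_inP=> cov; exists ps; split=> // e /cov/hasP.
rewrite negb_forall => /existsP[e]; rewrite negb_imply => /andP[eF].
move/hasPn=> ncov; have /eqP/cards2P[u [v [uv eE]]] := F_card2 eF.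
have ps_u : uniq (flatten ps) by rewrite (perm_uniq ps_V) enum_uniq.
have in_path z : exists2 p, p \in ps & z \in p.
  have : z \in flatten ps by rewrite (perm_mem ps_V) mem_enum.
  by case/flattenP=> p; exists p.
have [[|x p] p_ps up] // := in_path u; have [[|y q] q_ps vq] // := in_path v.
have := ncov _ p_ps; rewrite cycle_edges_rcons mem_rcons inE negb_or.
case/andP=> e_close enp; have := ncov _ q_ps.
rewrite cycle_edges_rcons mem_rcons inE negb_or => /andP[_ enq].
have [ue ve] : u \in e /\ v \in e by rewrite eE set21 set22.
have p_u := uniq_mem_flatten ps_u p_ps; have q_u := uniq_mem_flatten ps_u q_ps.
(* Both ends of [e] on one path would be its two endpoints, making [e] its closing edge, which
   counts as covered. *)
have pq : x :: p != y :: q.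
  apply/eqP=> E; move: q_ps vq enq q_u; rewrite -E => _ vp _ _.
  case: (path_endpoint p_u (ps_F _ p_ps) eF enp ue up) => Eu;
  case: (path_endpoint p_u (ps_F _ p_ps) eF enp ve vp) => Ev.
  - by rewrite Eu Ev eqxx in uv.
  - by rewrite eE {1}Eu {1}Ev setUC eqxx in e_close.
  - by rewrite eE {1}Eu {1}Ev eqxx in e_close.
  by rewrite Eu {1}Ev eqxx in uv.
have [x' [p' [pp' p'F lp']]] := orient_path p_u (ps_F _ p_ps) eF enp ue up.
have [y' [q' [qq' q'F lq']]] := orient_path q_u (ps_F _ q_ps) eF enq ve vq.
have ps_split : perm_eq ps ((x :: p) :: (y :: q) :: rem (y :: q) (rem (x :: p) ps)).
  rewrite (perm_trans (perm_to_rem p_ps)) // perm_cons perm_to_rem //.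
  by move: q_ps; rewrite (perm_mem (perm_to_rem p_ps)) inE eq_sym (negPf pq).
set rest := rem _ (rem _ _) in ps_split.
apply: (IH ((x' :: p' ++ rev (y' :: q')) :: rest)).
  by have := perm_size ps_split => /= E; rewrite E /= in size_ps *.
split.
  apply: perm_trans ps_V; rewrite perm_sym (permPl (perm_flatten ps_split)) /=.
  rewrite -!cat_cons catA perm_cat2r perm_sym perm_cat //.
  by rewrite perm_rev.
move=> r; rewrite inE => /predU1P[->|rr]; last first.
  by apply: ps_F; rewrite (perm_mem ps_split) !inE rr !orbT.
have : {subset path_edges (rev (y' :: q')) <= F} by move=> f /path_edges_rev/q'F.
have -> : rev (y' :: q') = v :: rev (belast y' q') by rewrite lastI rev_rcons lq'.
move=> qF f; rewrite path_edges_cat mem_cat inE -lp' -eE.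
by case/or3P=> [/p'F|/eqP->|/qF].
Qed.

End Decomposition.

(** * Cutting a path into short pieces without relatively light edges *)

Section Splitting.
Variables (R : realType) (V : finType) (w : {set V} -> R).
Implicit Types (p q : seq V).

Definition path_weight p : R := \sum_(e <- path_edges p) w e.

Lemma path_weight_cat x a y b :
  path_weight (x :: a ++ y :: b) =
  path_weight (x :: a) + (w [set last x a; y] + path_weight (y :: b)).
Proof. by rewrite /path_weight path_edges_cat big_cat big_cons. Qed.

Lemma path_weight_ge0 p :
  {in path_edges p, forall e, 0 <= w e} -> 0 <= path_weight p.
Proof. by move=> w0; rewrite /path_weight big_seq sumr_ge0. Qed.

Lemma path_weight_set p :
  uniq p -> path_weight p = weight w [set e in path_edges p].
Proof.
move=> /uniq_path_edges up; rewrite /path_weight /weight big_uniq //=.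
by apply: eq_bigl => e; rewrite inE.
Qed.

(** Averaging, by keeping the lighter of the first edge and the edge found in the rest. The edge is
    returned as a cut of the vertex list, the form that [path_weight_cat] needs. *)
Lemma cheap_edge x p : p != [::] -> exists c y d, p = c ++ y :: d /\
  (size p)%:R * w [set last x c; y] <= path_weight (x :: p).
Proof.
elim: p x => // z p IH x _; have [->|p0] := eqVneq p [::].
  by exists [::], z, [::]; rewrite /path_weight /= big_seq1 mul1r.
have [c [y [d [E le_w]]]] := IH z p0.
rewrite -[x :: z :: p]/(x :: [::] ++ z :: p) path_weight_cat {1}/path_weight.
rewrite big_nil add0r /= -(addn1 (size p)) natrD.
set m := w [set last z c; y] in le_w; set m' := w [set x; z].
have [le_m|lt_m] := lerP m' m.
  exists [::], z, p; split=> //; rewrite -/m' mulrDl mul1r addrC lerD2l.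
  by apply: le_trans le_w; rewrite ler_wpM2l.
exists (z :: c), y, d; split; first by rewrite E.
by rewrite /= -/m mulrDl mul1r addrC lerD // ltW.
Qed.

Lemma cheap_path_edge p : (1 < size p)%N ->
  exists2 e, e \in path_edges p & (size p).-1%:R * w e <= path_weight p.
Proof.
case: p => [|x [|z p]] // _.
have [//|c [y [d [-> le_w]]]] := @cheap_edge x (z :: p) _.
exists [set last x c; y] => //.
by rewrite path_edges_cat mem_cat mem_head orbT.
Qed.

Lemma path_weight_flatten (qs : seq (seq V)) :
  {in path_edges (flatten qs), forall e, 0 <= w e} ->
  \sum_(q <- qs) path_weight q <= path_weight (flatten qs).
Proof.
elim: qs => [|q qs IH] w0; first by rewrite big_nil path_weight_ge0.
have /IH {}IH : {in path_edges (flatten qs), forall e, 0 <= w e}.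
  move=> e eqs; apply: w0.
  have := @path_edges_flatten _ (flatten qs) [:: q; flatten qs].
  by rewrite /= cats0; apply; rewrite // !inE eqxx orbT.
rewrite big_cons /=; case: q w0 => [|x a] w0.
  by rewrite /path_weight big_nil add0r.
case E: (flatten qs) IH w0 => [|y b] IH w0.
  by rewrite cats0 -lerBrDl (le_trans IH) // /path_weight big_nil subrr.
rewrite path_weight_cat lerD2l (le_trans IH) // lerDr; apply: w0.
by rewrite -[flatten _]/((x :: a) ++ flatten qs) E path_edges_cat mem_cat mem_head orbT.
Qed.

(** Local estimates add up. This serves both the second cutting round inside a path and the passage
    from one component to all. *)
Lemma refine_flatten (P : seq V -> Prop) (f g : seq V -> R) (ps : seq (seq V)) :
  (forall p, p \in ps -> exists qs, [/\ perm_eq (flatten qs) p,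
    forall q, q \in qs -> P q & g p <= \sum_(q <- qs) f q]) ->
  exists qs, [/\ perm_eq (flatten qs) (flatten ps),
    forall q, q \in qs -> P q & \sum_(p <- ps) g p <= \sum_(q <- qs) f q].
Proof.
elim: ps => [|p ps IH] H; first by exists [::]; rewrite !big_nil.
have [|qs [qs_ps qsP le_qs]] := IH.
  by move=> q qps; apply: H; rewrite inE qps orbT.
have [qs' [qs'_p qs'P le_qs']] := H p (mem_head _ _).
exists (qs' ++ qs); rewrite flatten_cat perm_cat // big_cons big_cat lerD //=.
by split=> // q; rewrite mem_cat => /orP[/qs'P|/qsP].
Qed.

(** [x :: a] is the start of the current piece, [b] what lies ahead. The next cut is a cheap edge
    among the [L] edges that follow [last x a], so a piece has at most [2L] vertices. The part of
    this run behind the cut starts the next piece, so successive runs are disjoint and [L] times the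
    cut edges weighs at most the edges ahead. *)
Lemma split_length_rec (L n : nat) b x a : (0 < L)%N ->
  (size b <= n)%N -> (size (x :: a) <= L)%N ->
  {in path_edges (x :: a ++ b), forall e, 0 <= w e} ->
  exists qs, [/\ flatten qs = x :: a ++ b,
    forall q, q \in qs -> (size q <= L.*2)%N
    & L%:R * (path_weight (x :: a ++ b) - \sum_(q <- qs) path_weight q)
      <= path_weight (last x a :: b)].
Proof.
move=> L0; elim: n b x a => [|n IH] b x a size_b size_a w0.
  move: size_b; rewrite leqn0 => /nilP E; rewrite E cats0 in w0 *.
  exists [:: x :: a]; split=> [|q|]; rewrite ?inE /= ?cats0 //.
    by move/eqP->; rewrite (leq_trans size_a) // -addnn leq_addr.
  by rewrite big_seq1 subrr mulr0 /path_weight big_nil.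
have w0b : 0 <= path_weight (last x a :: b).
  apply: path_weight_ge0 => e eb; apply: w0.
  by rewrite /= pairmap_cat mem_cat; apply/orP; right.
have [le_b|lt_b] := leqP (size b) L.
  exists [:: x :: a ++ b]; split=> [|q|]; rewrite ?inE /= ?cats0 //.
    by move/eqP->; rewrite /= size_cat -addSn -addnn leq_add.
  by rewrite big_seq1 subrr mulr0.
have Eb := cat_take_drop L b.
set b1 := take L b in Eb; set b2 := drop L b in Eb.
have size_b1 : size b1 = L by rewrite size_takel // ltnW.
have b1_0 : b1 != [::] by rewrite -size_eq0 size_b1 -lt0n.
have [c [y [d [E1 le_w]]]] := cheap_edge (last x a) b1_0.
have Eab : x :: a ++ b = x :: (a ++ c) ++ y :: (d ++ b2).
  by rewrite -Eb E1 -!catA.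
have [|||qs [Eqs qs_size qs_w]] := IH b2 y d.
- rewrite -ltnS (leq_trans _ size_b) // -Eb size_cat size_b1.
  by rewrite -[X in (X < _)%N]add0n ltn_add2r.
- by rewrite -size_b1 E1 size_cat leq_addl.
- move=> e ee; apply: w0; rewrite Eab path_edges_cat mem_cat inE.
  by rewrite ee !orbT.
exists ((x :: a ++ c) :: qs); split.
- by rewrite /= Eqs Eab.
- move=> q; rewrite inE => /predU1P[->|/qs_size//].
  rewrite /= size_cat -addSn -addnn leq_add // -size_b1 E1 size_cat.
  exact: leq_addr.
rewrite big_cons Eab path_weight_cat last_cat.
have -> : path_weight (last x a :: b) =
    path_weight (last x a :: b1) + path_weight (last y d :: b2).
  rewrite -Eb /path_weight /= pairmap_cat big_cat /= E1 last_cat /=.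
  by [].
rewrite size_b1 in le_w.
set s := \sum_(q <- qs) _ in qs_w *.
rewrite [X in _ * X](_ : _ = w [set last (last x a) c; y] +
  (path_weight (y :: d ++ b2) - s)); last by ring.
by rewrite mulrDr lerD.
Qed.

Lemma split_length (L : nat) p : (0 < L)%N ->
  {in path_edges p, forall e, 0 <= w e} ->
  exists qs, [/\ flatten qs = p,
    forall q, q \in qs -> (size q <= L.*2)%N
    & L%:R * (path_weight p - \sum_(q <- qs) path_weight q) <= path_weight p].
Proof.
case: p => [|x p] L0 w0.
  by exists [::]; rewrite big_nil subr0 /path_weight big_nil mulr0.
exact: (@split_length_rec L (size p) p x [::]).
Qed.

(** The first piece is kept apart as [x :: q], so that a new front vertex can extend it over a heavy
    edge or start a new piece at a light one. Each of the at most [size p] lost edges weighs less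
    than [t]. *)
Lemma split_light_rec (t : R) x p : 0 <= t -> exists q qs,
  [/\ p = q ++ flatten qs,
    forall r, r \in (x :: q) :: qs -> {in path_edges r, forall e, t <= w e}
    & path_weight (x :: p) - (size p)%:R * t
      <= \sum_(r <- (x :: q) :: qs) path_weight r].
Proof.
move=> t0; elim: p x => [|y p IH] x.
  exists [::], [::]; split=> [//|r|]; first by rewrite inE => /eqP->.
  by rewrite big_seq1 mul0r subr0.
have [q [qs [-> qsP]]] := IH y; set p' := q ++ _ => le_w.
rewrite -[x :: y :: p']/(x :: [::] ++ y :: p') path_weight_cat.
rewrite {1}/path_weight big_nil add0r.
have [lt_w|le_t] := ltP (w [set x; y]) t.
  exists [::], ((y :: q) :: qs); split=> // [r|].
    by rewrite inE => /predU1P[->|/qsP].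
  rewrite big_cons {2}/path_weight big_nil add0r (le_trans _ le_w) //=.
  by rewrite -addn1 natrD; lra.
exists (y :: q), qs; split=> // [r|].
  rewrite inE => /predU1P[-> e|rqs]; last by apply: qsP; rewrite inE rqs orbT.
  by rewrite inE => /predU1P[->//|]; apply: (qsP (y :: q)); rewrite mem_head.
rewrite -[x :: y :: q]/(x :: [::] ++ y :: q) big_cons path_weight_cat.
rewrite [X in _ <= X + _ + _]/path_weight big_nil add0r -addrA.
by move: le_w; rewrite big_cons /= -[(size p').+1]addn1 natrD; lra.
Qed.

Lemma split_light (t : R) p : 0 <= t -> exists qs,
  [/\ flatten qs = p,
    forall q, q \in qs -> {in path_edges q, forall e, t <= w e}
    & path_weight p - (size p)%:R * t <= \sum_(q <- qs) path_weight q].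
Proof.
case: p => [|x p] t0.
  by exists [::]; rewrite big_nil mul0r subr0 /path_weight big_nil.
have [q [qs [-> qsP le_w]]] := split_light_rec x p t0.
exists ((x :: q) :: qs); split=> //; apply: le_trans le_w.
by rewrite lerD2l lerN2 ler_wpM2r // ler_nat.
Qed.

(** Runs of at most [2L] vertices are cut first, at a loss of a fraction [1/L]. Each run is then cut
    at its edges lighter than [d] times its weight; there are at most [2L] of them. *)
Lemma split_path (L : nat) (d : R) p : (0 < L)%N -> 0 <= d ->
  {in path_edges p, forall e, 0 <= w e} ->
  exists qs, [/\ perm_eq (flatten qs) p,
    forall q, q \in qs -> [/\ (size q <= L.*2)%N,
      {subset path_edges q <= path_edges p}
      & {in path_edges q, forall e, d * path_weight q <= w e}]
    & path_weight p - (L%:R^-1 + L.*2%:R * d) * path_weight p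
      <= \sum_(q <- qs) path_weight q].
Proof.
move=> L0 d0 w0; have [ps [Eps size_ps le_ps]] := split_length L0 w0.
have ps_sub q : q \in ps -> {subset path_edges q <= path_edges p}.
  by move=> /path_edges_flatten; rewrite Eps.
have ps_sum : \sum_(q <- ps) path_weight q <= path_weight p.
  by rewrite -Eps path_weight_flatten // Eps.
pose P q := [/\ (size q <= L.*2)%N, {subset path_edges q <= path_edges p}
      & {in path_edges q, forall e, d * path_weight q <= w e}].
pose g q := path_weight q - L.*2%:R * (d * path_weight q).
have [q qps|qs [qs_ps qsP le_qs]] := @refine_flatten P path_weight g ps.
  have w0q : {in path_edges q, forall e, 0 <= w e} by move=> e /(ps_sub _ qps)/w0.
  have t0 : 0 <= d * path_weight q by rewrite mulr_ge0 ?path_weight_ge0.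
  have [qs [Eqs qsP le_qs]] := split_light q t0.
  exists qs; split; first by rewrite Eqs.
    move=> r rqs; have r_q : {subset path_edges r <= path_edges q}.
      by rewrite -Eqs; apply: path_edges_flatten.
    split=> [|e /r_q/(ps_sub _ qps)//|e er].
      rewrite (leq_trans _ (size_ps _ qps)) // -Eqs.
      by case/splitPr: rqs => s1 s2; rewrite flatten_cat !size_cat addnCA leq_addr.
    (* The threshold was set by the run [q]; its piece [r] weighs no more, so the bound also holds
       relative to [r]. *)
    apply: le_trans (qsP r rqs e er); rewrite ler_wpM2l //.
    have w0f : {in path_edges (flatten qs), forall e, 0 <= w e} by rewrite Eqs.
    have := path_weight_flatten w0f; rewrite Eqs; apply: le_trans.
    rewrite (perm_big _ (perm_to_rem rqs)) big_cons lerDl big_seq sumr_ge0 //.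
    move=> s /mem_rem/path_edges_flatten s_q; apply: path_weight_ge0 => f fs.
    by apply: w0f; apply: s_q.
  apply: le_trans le_qs; rewrite lerD2l lerN2 ler_wpM2r //.
  by rewrite ler_nat size_ps.
exists qs; split=> //; first by rewrite -Eps.
apply: le_trans le_qs; rewrite /g sumrB -!mulr_sumr.
move: le_ps ps_sum; set s := \sum_(q <- ps) _ => le_ps ps_sum.
have Lr : 0 < L%:R :> R by rewrite ltr0n.
rewrite -ler_pdivlMl // in le_ps.
have : L.*2%:R * (d * s) <= L.*2%:R * d * path_weight p.
  by rewrite mulrA ler_wpM2l // mulr_ge0.
by rewrite mulrDl; lra.
Qed.

End Splitting.

(** * A lower bound on the gain by vertex charges *)

Section Gain.
Variables (R : realType) (V : finType) (w : {set V} -> R).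
Implicit Types (H M C D : {set {set V}}) (A : {set V}).

Definition incident_weight H v : R := \sum_(e in H | v \in e) w e.

Lemma sum_incident_weight H A :
  \sum_(v in A) incident_weight H v = \sum_(e in H) w e *+ #|e :&: A|.
Proof.
rewrite /incident_weight (exchange_big_dep (mem H)) /=; last first.
  by move=> v e _ /andP[].
apply: eq_bigr => e eH; rewrite -sumr_const; apply: eq_bigl => v.
by rewrite inE eH andbC.
Qed.

Lemma gain0 M : gain w M set0 = 0.
Proof.
rewrite /gain /weight set0D big_set0 big_pred0 ?subrr // => e.
by rewrite inE /cover big_set0 -setI_eq0 setI0 eqxx andbF.
Qed.

Lemma weight_le C D : C \subset D -> {in D, forall e, 0 <= w e} ->
  weight w C <= weight w D.
Proof.
move=> CD w0; rewrite /weight (big_setID C (A := D)) /= (setIidPr CD) lerDl.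
by apply: sumr_ge0 => e; rewrite inE => /andP[_ /w0].
Qed.

(* Allowing D to contain, besides C, further edges of M within A is what makes
   it free to open an alternating cycle at an edge of M. *)
Lemma gain_ge M M' C D A :
  {in M', forall e, 0 <= w e} -> {in C, forall e, 0 <= w e} ->
  matching_nbhd M C \subset M' -> D :&: M \subset M' -> M' \subset M ->
  D :\: M \subset C -> cover C \subset A ->
  {in D :&: M, forall e : {set V}, e \subset A /\ #|e| = 2} ->
  weight w D - \sum_(v in A) incident_weight M' v <= gain w M C.
Proof.
move=> w0 w0C nbM' DM' M'M DC CA DA; rewrite sum_incident_weight /gain.
have : weight w (D :\: M) <= weight w (C :\: M).
  apply: weight_le => [|e]; last by rewrite inE => /andP[_ /w0C].
  by rewrite subsetD DC -setI_eq0 setIDAC -setIDA setDv setI0 eqxx.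
rewrite [weight w D](big_setID M) /= -!/(weight w _).
suff : weight w (D :&: M) + weight w (matching_nbhd M C)
    <= \sum_(e in M') w e *+ #|e :&: A| by lra.
have sub (B : {set {set V}}) : B \subset M' -> weight w B = \sum_(e in M') w e *+ (e \in B).
  move=> BM'; rewrite /weight big_mkcond /= [RHS]big_mkcond /=.
  apply: eq_bigr => e _; case eB : (e \in B); last by rewrite mulr0n if_same.
  by rewrite (subsetP BM').
rewrite !sub // -big_split /=; apply: ler_sum => e eM'.
rewrite -mulrnDr ler_wpMn2l ?w0 //.
(* An edge of [D] in [M] has both ends in [A], which pay for its weight in [D] and in the
   neighborhood; any other neighborhood edge has at least one end in [A]. *)
have [eDM|_] := boolP (e \in D :&: M).
  have [/setIidPl-> ->] := DA e eDM.
  by case: (_ \in _).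
rewrite add0n; case: (boolP (e \in _)) => // ; rewrite inE => /andP[_].
rewrite -setI_eq0 => /set0Pn[v]; rewrite inE => /andP[ve vC].
by rewrite card_gt0; apply/set0Pn; exists v; rewrite inE ve (subsetP CA).
Qed.

End Gain.

(** * The symmetric difference of two matchings and its pieces *)

Section SymmetricDifference.
Variables (R : realType) (V : finType) (E : {set {set V}}) (w : {set V} -> R).
Variables (M N : {set {set V}}).
Hypotheses (E_simple : simple_graph E) (w_gt0 : forall e, e \in E -> 0 < w e).
Hypotheses (M_matching : matching E M) (N_matching : matching E N).
Implicit Types (p q : seq V).

Let F := (M :\: N) :|: (N :\: M).
Let pset p := [set e in path_edges p].
Let mu := incident_weight w (M :\: N).

Lemma symdiff_sub : F \subset E.
Proof.
case/andP: M_matching => ME _; case/andP: N_matching => NE _.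
by rewrite subUset !(subset_trans (subsetDl _ _)).
Qed.

(** An edge of [F] outside [M] lies in [N], so two distinct edges on the same side belong to a
    common matching and cannot meet. *)
Lemma symdiff_alternates u e f : e \in F -> f \in F ->
  u \in e -> u \in f -> e != f -> alternates M e f.
Proof.
case/andP: M_matching => _ /trivIsetP tM; case/andP: N_matching => _ /trivIsetP tN.
rewrite !inE /= => eF fF ue uf ef; apply/negP => /eqP E'.
case eM : (e \in M) in E' eF; rewrite -E' /= in fF.
  have := tM e f eM (esym E') ef; rewrite -setI_eq0 => /eqP/setP/(_ u).
  by rewrite !inE ue uf.
move: eF fF; rewrite /= !andbF /= => eN fN.
by have := tN e f eN fN ef; rewrite -setI_eq0 => /eqP/setP/(_ u); rewrite !inE ue uf.
Qed.

Lemma symdiff_degree2 u e f g : e \in F -> f \in F -> g \in F ->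
  u \in e -> u \in f -> u \in g -> [|| e == f, f == g | g == e].
Proof.
move=> eF fF gF ue uf ug; apply: contraT; rewrite !negb_or => /and3P[ef fg ge].
move: (symdiff_alternates eF fF ue uf ef) (symdiff_alternates fF gF uf ug fg).
move: (symdiff_alternates gF eF ug ue ge); rewrite /alternates /=.
by case: (e \in M); case: (f \in M); case: (g \in M).
Qed.

Lemma symdiff_path_alternates p : uniq p -> {subset path_edges p <= F} ->
  sorted (alternates M) (path_edges p).
Proof.
case: p => // x p; elim: p x => // y p IH x /= /andP[xp up] pF.
have := IH y up; case: p xp up pF {IH} => // z p xp up pF /= ->.
  rewrite andbT; apply: (@symdiff_alternates y); rewrite ?pF ?inE ?eqxx ?orbT //.
  apply/negP => /eqP/setP/(_ x); rewrite !inE eqxx => /esym/orP xyz.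
  by move: xp; rewrite !inE !negb_or; case: xyz => ->; rewrite ?andbF.
by move=> e ep; apply: pF; rewrite inE ep orbT.
Qed.

Lemma symdiff_alternating_path p : (1 < size p)%N -> uniq p ->
  {subset path_edges p <= F} -> alternating_path E M (pset p).
Proof.
move=> sp up pF; exists p; split=> //; last exact: symdiff_path_alternates.
by apply/subsetP=> e; rewrite inE => /pF/(subsetP symdiff_sub).
Qed.

(** An edge common to both matchings meets no edge of [F]. Hence [mu], which ignores common edges,
    pays for the whole neighborhood. *)
Lemma symdiff_nbhd (C : {set {set V}}) : C \subset F ->
  matching_nbhd M C \subset M :\: N.
Proof.
move=> CF; apply/subsetP => e; rewrite !inE => /andP[eM].
rewrite eM andbT -setI_eq0 => /set0Pn[v]; rewrite inE => /andP[ve /bigcupP[f fC vf]].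
apply/negP => eN; have /(subsetP CF) := fC.
case/andP: M_matching => _ /trivIsetP tM; case/andP: N_matching => _ /trivIsetP tN.
have [<-|ef] := eqVneq e f; first by rewrite !inE eM eN.
rewrite !inE => /orP[]/andP[_ ff].
  by have := tM e f eM ff ef; rewrite -setI_eq0 => /eqP/setP/(_ v); rewrite !inE ve vf.
by have := tN e f eN ff ef; rewrite -setI_eq0 => /eqP/setP/(_ v); rewrite !inE ve vf.
Qed.

Lemma symdiff_w_ge0 e : e \in F -> 0 <= w e.
Proof. by move=> /(subsetP symdiff_sub)/w_gt0/ltW. Qed.

(** [D] will be either the edge set of [q] or a whole cycle that [q] opens at an edge of [M]. *)
Lemma symdiff_gain_ge (D : {set {set V}}) q : uniq q -> D \subset F ->
  {subset path_edges q <= F} -> D :\: M \subset pset q ->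
  {in D, forall e : {set V}, e \subset [set x in q]} ->
  weight w D - \sum_(v <- q) mu v <= gain w M (pset q).
Proof.
move=> uq DF qF Dq Dsub.
have -> : \sum_(v <- q) mu v = \sum_(v in [set x in q]) mu v.
  by rewrite big_uniq //=; apply: eq_bigl => v; rewrite inE.
have CF : pset q \subset F by apply/subsetP => e; rewrite inE => /qF.
apply: gain_ge => //.
- by move=> e eM; apply: symdiff_w_ge0; rewrite inE eM.
- by move=> e /(subsetP CF)/symdiff_w_ge0.
- exact: symdiff_nbhd.
- apply/subsetP => e; rewrite inE => /andP[/(subsetP DF)].
  by rewrite !inE => /orP[//|/andP[/negPf->]].
- exact: subsetDl.
- apply/bigcupsP => e; rewrite inE => /path_edge_sub/subsetP sub.
  by apply/subsetP => x /sub; rewrite inE.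
move=> e; rewrite inE => /andP[eD _]; split; first exact: Dsub.
by apply: E_simple; apply: (subsetP symdiff_sub); apply: (subsetP DF).
Qed.

Variables (L : nat) (d : R).
Hypotheses (L_gt0 : (0 < L)%N) (d_ge0 : 0 <= d).
(** The fraction of its weight that a path may lose in [split_path]. *)
Let eta := L%:R^-1 + L.*2%:R * d.

Let piece q := [/\ (size q <= L.*2)%N, {subset path_edges q <= F}
  & {in path_edges q, forall e, d * path_weight w q <= w e}].

(** Cutting loses edges but no vertices, so the charges [mu] of the pieces add up to that of [p]. *)
Lemma open_path_pieces p : uniq p -> {subset path_edges p <= F} ->
  exists qs, [/\ perm_eq (flatten qs) p, forall q, q \in qs -> piece q
    & path_weight w p - eta * path_weight w p - \sum_(v <- p) mu v
      <= \sum_(q <- qs) gain w M (pset q)].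
Proof.
move=> up pF; have w0 : {in path_edges p, forall e, 0 <= w e}.
  by move=> e /pF/symdiff_w_ge0.
have [qs [qs_p qsP le_qs]] := split_path L_gt0 d_ge0 w0; exists qs; split=> //.
  by move=> q /qsP[? sub ?]; split=> // e /sub/pF.
have -> : \sum_(v <- p) mu v = \sum_(q <- qs) \sum_(v <- q) mu v.
  by rewrite -big_flatten; apply: perm_big; rewrite perm_sym.
apply: le_trans (lerB le_qs (lexx _)) _; rewrite -sumrB big_seq [leRHS]big_seq.
apply: ler_sum => q qqs; have [_ sub _] := qsP q qqs.
have uq : uniq q by apply: uniq_mem_flatten qqs; rewrite (perm_uniq qs_p).
rewrite path_weight_set //; apply: symdiff_gain_ge => //.
- by apply/subsetP => e; rewrite inE => /sub/pF.
- by move=> e /sub/pF.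
- exact: subsetDl.
move=> e; rewrite inE => /path_edge_sub/subsetP sube.
by apply/subsetP => x /sube; rewrite inE.
Qed.

(** The first and the closing edge meet at [x] and are distinct thanks to a third vertex, so they
    alternate and one is in [M]. *)
Lemma cycle_matching_edge p : (2 < size p)%N -> uniq p ->
  {subset cycle_edges p <= F} -> exists2 e, e \in cycle_edges p & e \in M.
Proof.
case: p => [|x [|y p]] //; rewrite cycle_edges_rcons => sp up pF.
have e1 : [set x; y] \in rcons (path_edges [:: x, y & p]) [set last x (y :: p); x].
  by rewrite mem_rcons !inE eqxx orbT.
have e2 : [set last x (y :: p); x] \in
    rcons (path_edges [:: x, y & p]) [set last x (y :: p); x].
  by rewrite mem_rcons mem_head.
have : alternates M [set x; y] [set last x (y :: p); x].
  apply: (@symdiff_alternates x); rewrite ?pF ?set21 ?set22 //.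
  case: p sp up {pF e1 e2} => // z p _ up; apply/negP => /eqP/setP/(_ y).
  rewrite !inE eqxx orbT => /esym/orP[/eqP E'|/eqP E'].
    by move: E' (mem_last z p) up => /= <- yp /and3P[_]; rewrite yp.
  by move: up; rewrite E' /= mem_head.
move=> alt; case eM : ([set x; y] \in M); first by exists [set x; y].
by exists [set last x (y :: p); x]; last by move: alt; rewrite /alternates /= eM; case: (_ \in M).
Qed.

(** [cycle_edges] degenerates on short lists: on one vertex the closing set is a singleton, on two
    it repeats the path edge. *)
Lemma closing_edge p e : uniq p -> {subset path_edges p <= F} ->
  e \in cycle_edges p -> e \in F -> e \notin path_edges p ->
  (2 < size p)%N /\ {subset cycle_edges p <= F}.
Proof.
case: p => // x p up pF; rewrite cycle_edges_rcons mem_rcons inE.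
case/predU1P=> [->|->//] cF ncp; split; last first.
  by move=> f; rewrite mem_rcons inE => /predU1P[->|/pF].
case: p {up pF} cF ncp => [|y [|z p]] //=.
  by move/(subsetP symdiff_sub)/E_simple; rewrite setUid cards1.
by move=> _; rewrite inE (setUC [set y]) eqxx.
Qed.

(** [D] is the path together with its closing edge if that is in [F]. One loss of [eta] comes from
    cutting the opened path, the other from opening a cycle at a cheap edge. *)
Lemma path_pieces p : uniq p -> {subset path_edges p <= F} ->
  let D := [set e in cycle_edges p] :&: F in
  exists qs, [/\ perm_eq (flatten qs) p, forall q, q \in qs -> piece q
    & weight w D - 2 * eta * weight w D - \sum_(v <- p) mu v
      <= \sum_(q <- qs) gain w M (pset q)].
Proof.
move=> up pF D.
have DF : D \subset F by exact: subsetIr.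
have w0 : {in D, forall e, 0 <= w e} by move=> e /(subsetP DF)/symdiff_w_ge0.
have wD0 : 0 <= weight w D by apply: sumr_ge0.
have L0 : 0 < L%:R^-1 :> R by rewrite invr_gt0 ltr0n.
have eta0 : 0 <= eta by rewrite addr_ge0 ?mulr_ge0 // ltW.
have pD : pset p \subset D.
  apply/subsetP => e; rewrite inE => ep.
  by rewrite in_setI inE path_cycle_edges ?pF.
have eta_wD : 0 <= eta * weight w D by rewrite mulr_ge0.
have [Dp|nDp] := boolP (D \subset pset p).
  have [qs [qs_p qsP le_qs]] := open_path_pieces up pF; exists qs; split=> //.
  apply: le_trans le_qs; rewrite path_weight_set //.
  have -> : [set e in path_edges p] = D by apply/eqP; rewrite eqEsubset pD Dp.
  by lra.
have [sp cF] : (2 < size p)%N /\ {subset cycle_edges p <= F}.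
  case/subsetPn: nDp => e; rewrite in_setI inE => /andP[ec eF].
  by rewrite inE; apply: closing_edge eF.
have D_e e : e \in cycle_edges p -> e \in D by move=> ep; rewrite in_setI inE ep cF.
have open e : e \in cycle_edges p -> exists q, [/\ perm_eq q p, uniq q,
    {subset path_edges q <= F}, D \subset e |: pset q & pset q \subset D].
  move=> ec; have [q [qp qc cq]] := open_cycle ec; exists q; split=> //.
  - by rewrite (perm_uniq qp).
  - by move=> f /qc/cF.
  - by apply/subsetP => f; rewrite !inE => /andP[/cq]; rewrite inE.
  by apply/subsetP => f; rewrite inE => /qc/D_e.
have [/andP[size_p heavy]|light] := boolP ((size p <= L.*2)%N &&
    [forall (e | e \in D), d * weight w D <= w e]).
  have [e ec eM] := cycle_matching_edge sp up cF.
  have [q [qp uq qF Dq qD]] := open e ec; exists [:: q]; split.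
  - by rewrite /= cats0.
  - move=> r; rewrite inE => /eqP->; split=> //; first by rewrite (perm_size qp).
    move=> f fq; have fD : f \in D by apply: (subsetP qD); rewrite inE.
    move/forall_inP: heavy => /(_ f fD); apply: le_trans; rewrite ler_wpM2l //.
    by rewrite path_weight_set // weight_le.
  rewrite big_seq1 -(perm_big _ qp) /=.
  have : weight w D - \sum_(v <- q) mu v <= gain w M (pset q).
    apply: symdiff_gain_ge => //.
      apply/subsetP => f; rewrite inE => /andP[fM /(subsetP Dq)].
      by rewrite in_setU1 => /predU1P[Ef|//]; rewrite Ef eM in fM.
    move=> f; rewrite 2!inE => /andP[/cycle_edge_sub/subsetP fp _].
    by apply/subsetP => x /fp; rewrite inE (perm_mem qp).
  by lra.
(* More than [2L] vertices give an edge of weight at most [w(D) / L]; otherwise some edge is lighter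
   than [d * w(D)]. Both bounds are below [eta * w(D)]. *)
have [e ec e_light] : exists2 e, e \in cycle_edges p & w e <= eta * weight w D.
  move: light; rewrite negb_and -ltnNge => /orP[long|].
    have [|e ep le_w] := @cheap_path_edge _ _ w p; first by apply: ltn_trans sp.
    exists e; first exact: path_cycle_edges.
    have wp : path_weight w p <= weight w D by rewrite path_weight_set // weight_le.
    have e0 : 0 <= w e by apply/symdiff_w_ge0/pF.
    have : L%:R * w e <= weight w D.
      apply: le_trans wp; apply: le_trans le_w; rewrite ler_wpM2r // ler_nat.
      by move: long => /=; lia.
    rewrite -ler_pdivlMl ?ltr0n // => le1; apply: le_trans le1 _.
    by rewrite mulrDl lerDl !mulr_ge0.
  rewrite negb_forall => /existsP[e]; rewrite negb_imply -ltNge => /andP[eD lt_e].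
  exists e; first by move: eD; rewrite 2!inE => /andP[].
  apply: ltW; apply: lt_le_trans lt_e _; rewrite ler_wpM2r //.
  rewrite -[leLHS]mul1r -[leLHS]add0r lerD ?(ltW L0) // ler_wpM2r //.
  by rewrite ler1n double_gt0.
have [q [qp uq qF Dq qD]] := open e ec.
have [qs [qs_q qsP le_qs]] := open_path_pieces uq qF; exists qs; split=> //.
  exact: perm_trans qs_q qp.
apply: le_trans le_qs; rewrite -(perm_big _ qp) /= lerD2r path_weight_set //.
have : weight w D <= w e + weight w (pset q).
  have := @weight_le _ _ w D (e |: pset q) Dq; rewrite {2}/weight.
  have e0 : 0 <= w e by apply: w0; apply: D_e.
  have q0 : {in e |: pset q, forall f, 0 <= w f}.
    by move=> f; rewrite !inE => /predU1P[->|/qF/symdiff_w_ge0].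
  move/(_ q0) => /le_trans; apply.
  have [eq|neq] := boolP (e \in pset q); last by rewrite big_setU1.
  by rewrite (setUidPr _) ?sub1set // lerDr.
have : eta * weight w (pset q) <= eta * weight w D.
  by rewrite ler_wpM2l // weight_le.
by lra.
Qed.

Lemma sum_incident_weightT (H : {set {set V}}) : H \subset E ->
  \sum_(v : V) incident_weight w H v = 2 * weight w H.
Proof.
move=> /subsetP HE; have := sum_incident_weight w H [set: V].
under eq_bigl do rewrite inE; move=> ->; rewrite /weight mulr_sumr.
by apply: eq_bigr => e /HE/E_simple E2; rewrite setIT E2 mulr_natl.
Qed.

Lemma weight_le_incident (D : {set {set V}}) p : D \subset F -> uniq p ->
  {in D, forall e : {set V}, e \subset p} ->
  weight w D <= \sum_(v <- p) incident_weight w F v.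
Proof.
move=> DF up Dp; pose A := [set x in p].
have -> : \sum_(v <- p) incident_weight w F v = \sum_(v in A) incident_weight w F v.
  by rewrite big_uniq //=; apply: eq_bigl => v; rewrite inE.
rewrite sum_incident_weight (big_setID D) /= (setIidPr DF) ler_wpDr //.
  by apply: sumr_ge0 => e; rewrite inE => /andP[_ eF]; rewrite mulrn_wge0 ?symdiff_w_ge0.
apply: ler_sum => e eD; have eF := subsetP DF e eD.
have /setIidPl-> : e \subset A.
  by apply/subsetP => x xe; rewrite inE (subsetP (Dp e eD)).
by rewrite E_simple ?(subsetP symdiff_sub) // mulr2n lerDl symdiff_w_ge0.
Qed.

(** Each edge is charged to its ends, which turns disjointness of the vertex lists into the bound;
    the factor 2 is the handshake count over [V]. *)
Lemma sum_weight_le (D : seq V -> {set {set V}}) ps :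
  perm_eq (flatten ps) (enum V) ->
  (forall p, p \in ps -> D p \subset F /\ {in D p, forall e : {set V}, e \subset p}) ->
  \sum_(p <- ps) weight w (D p) <= 2 * weight w F.
Proof.
move=> ps_V HD; rewrite -sum_incident_weightT; last exact: symdiff_sub.
rewrite -[leRHS]big_enum -(perm_big _ ps_V) big_flatten /= big_seq [leRHS]big_seq.
apply: ler_sum => p pps; have [DF Dp] := HD p pps; apply: weight_le_incident => //.
by apply: uniq_mem_flatten pps; rewrite (perm_uniq ps_V) enum_uniq.
Qed.

(** The sets [D p] cover [F] and the charges total [2 w(M :\: N)], so
    [w(F) - 2 w(M :\: N) = w(N) - w(M)] remains. The loss [2 eta] of [path_pieces] is doubled by
    [sum_weight_le]. *)
Lemma symdiff_pieces : exists qs, [/\ perm_eq (flatten qs) (enum V),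
  forall q, q \in qs -> piece q
  & weight w N - weight w M - 4 * eta * weight w F
    <= \sum_(q <- qs) gain w M (pset q)].
Proof.
have F_card2 e : e \in F -> #|e| = 2 by move=> /(subsetP symdiff_sub)/E_simple.
have [ps [ps_V psF ps_cover]] := path_decomposition F_card2 symdiff_degree2.
have ps_uniq p : p \in ps -> uniq p.
  by move=> pps; apply: uniq_mem_flatten pps; rewrite (perm_uniq ps_V) enum_uniq.
pose D p := [set e in cycle_edges p] :&: F.
have [p pps|qs [qs_ps qsP le_qs]] := @refine_flatten _ _ piece
  (fun q => gain w M (pset q))
  (fun p => weight w (D p) - 2 * eta * weight w (D p) - \sum_(v <- p) mu v) ps.
  exact: path_pieces (ps_uniq p pps) (psF p pps).
exists qs; split=> //; first exact: perm_trans qs_ps ps_V.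
apply: le_trans le_qs; rewrite !sumrB -mulr_sumr -big_flatten (perm_big _ ps_V).
rewrite big_enum /= sum_incident_weightT; last first.
  by case/andP: M_matching => ME _; apply: subset_trans (subsetDl _ _) ME.
have : \sum_(p <- ps) weight w (D p) <= 2 * weight w F.
  apply: sum_weight_le => // p pps; split; first exact: subsetIr.
  by move=> e; rewrite in_setI inE => /andP[/cycle_edge_sub].
have : weight w F <= \sum_(p <- ps) weight w (D p).
  have -> : \sum_(p <- ps) weight w (D p) =
      \sum_(e in F) \sum_(p <- ps | e \in cycle_edges p) w e.
    rewrite [RHS](exchange_big_dep xpredT) //=; apply: eq_bigr => p _.
    by apply: eq_bigl => e; rewrite in_setI inE andbC.
  apply: ler_sum => e eF; have [p pps ep] := ps_cover e eF.
  rewrite (big_rem p) //= ep lerDl; apply: sumr_ge0 => _ _.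
  exact: symdiff_w_ge0.
have -> : weight w F = weight w (M :\: N) + weight w (N :\: M).
  rewrite /weight [LHS](big_setID M) /=; congr (_ + _); apply: eq_bigl => e;
  by rewrite !inE; case: (e \in M); case: (e \in N).
have -> : weight w M = weight w (M :&: N) + weight w (M :\: N).
  by rewrite /weight (big_setID N).
have -> : weight w N = weight w (M :&: N) + weight w (N :\: M).
  by rewrite /weight (big_setID M) setIC.
set s := \sum_(p <- ps) _; set m := weight w (M :\: N); set n := weight w (N :\: M).
have eta0 : 0 <= eta by rewrite addr_ge0 ?mulr_ge0 // invr_ge0 ler0n.
move=> le1 /(ler_wpM2l eta0); rewrite mulrCA.
by lra.
Qed.

End SymmetricDifference.

(** * Enclosing powers and rounding errors *)

Section Rounding.
Variable R : realType.

Lemma exprz_floor (b x : R) : 1 < b -> 0 < x ->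
  exists i : int, b ^ i <= x < b ^ (i + 1).
Proof.
move=> b1 x0; have b0 : 0 < b by apply: lt_trans b1.
have unbounded (y : R) : 0 <= y -> exists n : nat, y < b ^+ n.
  move=> y0; have c0 : 0 < b - 1 by rewrite subr_gt0.
  exists (Num.bound (y / (b - 1))).
  have := archi_boundP (divr_ge0 y0 (ltW c0)); set n := Num.bound _.
  rewrite ltr_pdivrMr // => /lt_le_trans; apply.
  elim: n => [|n IH]; first by rewrite mul0r.
  have bn1 : 1 <= b ^+ n by rewrite exprn_ege1 // ltW.
  have : (b - 1) * 1 <= (b - 1) * b ^+ n by rewrite ler_wpM2l // ltW.
  by rewrite exprS -addn1 natrD; lra.
have [n xn] := unbounded x (ltW x0).
have [|m xm] := unbounded x^-1; first by rewrite invr_ge0 ltW.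
(* Exponents are shifted by [m], where [b ^ (- m) < x], so that the least one whose power exceeds
   [x] is sought among natural numbers; [i] is its predecessor. *)
have ex : exists k : nat, x < b ^ (k%:Z - m%:Z).
  by exists (n + m)%N; rewrite PoszD addrK.
case: (ex_minnP ex) => [[|k]] xk kmin.
  move: xk; rewrite sub0r -exprnN ltNge.
  by rewrite -[leRHS]invrK lef_pV2 ?posrE ?invr_gt0 ?exprn_gt0 // ltW.
exists (k%:Z - m%:Z); rewrite addrAC -PoszD addn1 xk andbT leNgt.
by apply/negP => /kmin; rewrite ltnn.
Qed.

Lemma round_up_le (d x : R) : 0 < d -> round_up d x <= x + d.
Proof.
move=> d0; have := ceilB1_lt (x / d); rewrite intrD => lt_x.
have /ltW := lt_x; rewrite lerBlDr -(ler_pM2r d0) mulrDl mul1r divfK ?gt_eqF //.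
Qed.

Lemma round_down_ge (d x : R) : 0 < d -> x - d <= round_down d x.
Proof.
move=> d0; have /ltW := floorD1_gt (x / d).
by rewrite intrD -(ler_pM2r d0) mulrDl mul1r divfK ?gt_eqF // lerBlDr.
Qed.

End Rounding.

(** Each such edge picks one of its vertices in [cover C]; disjoint edges pick different ones. *)
Lemma card_matching_nbhd (V : finType) (M C : {set {set V}}) :
  trivIset M -> (#|matching_nbhd M C| <= #|cover C|)%N.
Proof.
move=> /trivIsetP tM; pose f (e : {set V}) := [pick v in e :&: cover C].
have fP e : e \in matching_nbhd M C -> exists2 v, f e = Some v & v \in e :&: cover C.
  rewrite inE /f -setI_eq0 => /andP[_ /set0Pn[v ve]].
  by case: pickP => [u ue|/(_ v)]; [exists u | rewrite ve].
rewrite -(@card_in_imset _ _ f) => [|e g eC gC]; last first.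
  have [v fe] := fP e eC; have [v' fg] := fP g gC; rewrite fe fg !inE.
  move=> /andP[v'g _] /andP[ve _] [E]; apply/eqP; apply: contraT => eg.
  have /andP[eM _] : (e \in M) && ~~ [disjoint e & cover C] by rewrite inE in eC.
  have /andP[gM _] : (g \in M) && ~~ [disjoint g & cover C] by rewrite inE in gC.
  have := tM e g eM gM eg; rewrite -setI_eq0 => /eqP/setP/(_ v).
  by rewrite !inE ve E v'g.
rewrite -(card_imset (mem (cover C)) (@Some_inj _)) subset_leq_card //.
apply/subsetP => o /imsetP[e /fP[v -> ]]; rewrite inE => /andP[_ vC] ->.
exact: imset_f.
Qed.

(** * Membership of heavy pieces in an augmentation class *)

Section Classes.
Variables (R : realType) (V : finType) (E : {set {set V}}) (w : {set V} -> R).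
Variables (M : {set {set V}}) (eps : R).
Hypotheses (eps_bounds : 0 < eps < 1 / 16) (M_matching : matching E M).
Hypothesis w_ge0 : forall e, e \in E -> 0 <= w e.

(** Each rounding costs at most [d], and each of the two sums has at most [#|cover C|] terms. *)
Lemma gain_rounded_weight (C : {set {set V}}) d : 0 < d ->
  (#|C| <= #|cover C|)%N ->
  gain w M C - 2 * #|cover C|%:R * d <= gain (rounded_weight w M C d) M C.
Proof.
move=> d0 cC; case/andP: M_matching => _ tM.
have nb : weight (rounded_weight w M C d) (matching_nbhd M C)
    <= weight w (matching_nbhd M C) + #|cover C|%:R * d.
  apply: (@le_trans _ _ (\sum_(e in matching_nbhd M C) (w e + d))).
    by apply: ler_sum => e eC; rewrite /rounded_weight eC round_up_le.
  rewrite big_split /= lerD2l sumr_const -[d *+ _]mulr_natl ler_wpM2r ?(ltW d0) //.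
  by rewrite ler_nat card_matching_nbhd.
have cm : weight w (C :\: M) - #|cover C|%:R * d
    <= weight (rounded_weight w M C d) (C :\: M).
  apply: (@le_trans _ _ (\sum_(e in C :\: M) (w e - d))).
    rewrite sumrB lerD2l lerN2 sumr_const -[d *+ _]mulr_natl ler_wpM2r ?(ltW d0) //.
    by rewrite ler_nat (leq_trans _ cC) // subset_leq_card ?subsetDl.
  apply: ler_sum => e; rewrite inE /rounded_weight inE => /andP[/negPf-> _].
  exact: round_down_ge.
by rewrite /gain; lra.
Qed.

(** For the largest power [W] not above [w(C)], [w(C) < (1 + eps^4) W <= 2W] gives the upper bounds,
    and [W <= w(C)] the lower ones. *)
Lemma augmentation_in_class (C : {set {set V}}) :
  augmentation E M C -> C \subset E -> (#|C| <= #|cover C|)%N -> 0 < weight w C ->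
  {in C, forall e, eps ^+ 12 * weight w C <= w e} ->
  eps ^+ 8 * weight w C <= gain w M C ->
  #|cover C|%:R <= 64 / eps ^+ 2 + 1 ->
  exists i : int, [/\ 1 <= weight w C -> 0 <= i,
    (1 + eps ^+ 4) ^ i <= weight w C
    & augmentation_class E w M eps ((1 + eps ^+ 4) ^ i) C].
Proof.
case/andP: eps_bounds => e0 e16 augC CE cardC wC0 heavy gainC coverC.
have w0C : {in C, forall e, 0 <= w e} by move=> e /(subsetP CE)/w_ge0.
have e4 : 0 < eps ^+ 4 by rewrite exprn_gt0.
have b1 : 1 < 1 + eps ^+ 4 by rewrite ltrDl.
have [i /andP[le_i lt_i]] := exprz_floor b1 wC0; exists i; split=> //.
  move=> wC1; rewrite leNgt; apply/negP => i0.
  have : (1 + eps ^+ 4) ^ (i + 1) <= (1 + eps ^+ 4) ^ 0.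
    by rewrite ler_eXz2l // -ltzD1 ltrD2r.
  by rewrite expr0z; move: lt_i wC1; lra.
set W := _ ^ i in le_i *.
have W0 : 0 < W by rewrite exprz_gt0 // (lt_trans _ b1).
have wC2 : weight w C <= 2 * W.
  apply: ltW; apply: lt_le_trans lt_i _.
  rewrite exprzDr ?unitfE ?gt_eqF ?(lt_trans _ b1) // expr1z -/W mulrC ler_wpM2r ?(ltW W0) //.
  have : eps ^+ 4 <= 1 by rewrite exprn_ile1 ?(ltW e0) //; lra.
  by lra.
have d0 : 0 < eps ^+ 12 * W by rewrite mulr_gt0 ?exprn_gt0.
split=> //.
- move=> e eC; rewrite (le_trans _ (heavy e eC)) /=; last first.
    by rewrite ler_wpM2l ?exprn_ge0 ?(ltW e0) ?(ltW W0).
  apply: le_trans wC2; rewrite /weight (bigD1 e) //= lerDl sumr_ge0 // => f.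
  by case/andP=> /w0C.
- apply: le_trans wC2; rewrite /gain lerBlDr ler_wpDr //.
    case/andP: M_matching => ME _; apply: sumr_ge0 => e; rewrite inE => /andP[eM _].
    by apply/w_ge0/(subsetP ME).
  by apply: weight_le w0C; apply: subsetDl.
apply: le_trans (gain_rounded_weight d0 cardC).
have gW : eps ^+ 8 * W <= gain w M C.
  by apply: le_trans gainC; rewrite ler_wpM2l ?exprn_ge0 ?(ltW e0) ?(ltW W0).
have cW : 2 * #|cover C|%:R * (eps ^+ 12 * W) <=
    2 * (64 / eps ^+ 2 + 1) * (eps ^+ 12 * W).
  by rewrite ler_wpM2r ?(ltW d0) // ler_wpM2l.
have E1 : 2 * (64 / eps ^+ 2 + 1) * (eps ^+ 12 * W) =
    (128 * eps ^+ 2 + 2 * eps ^+ 4) * (eps ^+ 8 * W).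
  by field; rewrite gt_eqF.
have E2 : eps ^+ 12 * W = eps ^+ 4 * (eps ^+ 8 * W) by ring.
have eW : 0 <= eps ^+ 8 * W by rewrite mulr_ge0 ?exprn_ge0 ?(ltW e0) ?(ltW W0).
have e2 : eps ^+ 2 <= 1 / 256 by rewrite expr2; nra.
have e42 : eps ^+ 4 <= 1 / 256 * (1 / 256).
  by rewrite (exprD _ 2 2) ler_pM // ?exprn_ge0 ?(ltW e0).
(* In units of [eps^8 W], rounding costs [128 eps^2 + 2 eps^4]; one further [eps^4] is the gain
   [eps^12 W] that must remain. *)
have : (128 * eps ^+ 2 + 3 * eps ^+ 4) * (eps ^+ 8 * W) <= 1 * (eps ^+ 8 * W).
  by rewrite ler_wpM2r //; lra.
move=> small; rewrite lerBrDr; apply: le_trans (lerD (lexx _) cW) _.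
by rewrite E1 E2; lra.
Qed.

End Classes.

(** * Choice of the run length and assembly of the collection *)

Lemma gain_budget (R : realType) (eps : R) : 0 < eps < 1 / 16 ->
  exists2 L : nat, (0 < L)%N & L.*2%:R <= 64 / eps ^+ 2 /\
  eps ^+ 2 / 200 <=
    eps - 8 * (L%:R^-1 + L.*2%:R * eps ^+ 12) - 4 * eps ^+ 8.
Proof.
case/andP => e0 e16; have x0 : 0 < eps ^+ 2 by rewrite exprn_gt0.
have e1 : eps ^+ 2 <= eps / 16 by rewrite expr2; nra.
have y0 : 0 <= 32 / eps ^+ 2 by rewrite divr_ge0 // ltW.
(* The largest [L] with [2L <= 64 / eps^2]. Then [1/L <= eps^2 / 31], and [eps >= 16 eps^2] leaves
   ample room. *)
exists (Num.truncn (32 / eps ^+ 2)).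
  rewrite -ltnS -(ltr_nat R); apply: le_lt_trans (truncnS_gt _).
  by rewrite ler_pdivlMr //; lra.
have /andP[le_L lt_L] := truncn_itv y0; set L := Num.truncn _ in le_L lt_L *.
have L2 : L.*2%:R = 2 * L%:R :> R by rewrite -muln2 natrM mulrC.
split; first by rewrite L2; lra.
have L31 : 31 <= L%:R * eps ^+ 2.
  move: lt_L; rewrite ltr_pdivrMr // -[L.+1]addn1 natrD mulrDl mul1r; lra.
have L0 : 0 < L%:R :> R by rewrite -(pmulr_lgt0 _ x0); lra.
have Linv : L%:R^-1 <= eps ^+ 2 / 31.
  by rewrite ler_pdivlMr // ler_pdivrMl.
have e8 : eps ^+ 8 <= eps ^+ 2 / 256.
  have -> : eps ^+ 8 = eps ^+ 2 * eps ^+ 6 by ring.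
  rewrite ler_wpM2l ?(ltW x0) // (exprD _ 2 4).
  have : eps ^+ 4 <= 1 by rewrite exprn_ile1 ?(ltW e0) //; lra.
  have : eps ^+ 2 <= 1 / 256 by lra.
  by nra.
have Le : L.*2%:R * eps ^+ 12 <= eps ^+ 2 / 256.
  apply: (@le_trans _ _ (64 / eps ^+ 2 * eps ^+ 12)).
    by rewrite ler_wpM2r ?exprn_ge0 ?(ltW e0) // L2; lra.
  have -> : 64 / eps ^+ 2 * eps ^+ 12 = 64 * eps ^+ 2 * eps ^+ 8.
    by field; rewrite gt_eqF.
  apply: le_trans e8; rewrite -[leRHS]mul1r ler_wpM2r ?exprn_ge0 ?(ltW e0) //; lra.
by lra.
Qed.

(* The exponent i is an integer, and a natural number whenever w(C) >= 1. If
   w(C) < 1, which positive weights allow, then no natural i satisfies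
   (1 + eps^4)^i <= w(C). *)
Theorem theorem6 (R : realType) (V : finType) (E : {set {set V}})
    (w : {set V} -> R) (Mopt M : {set {set V}}) (eps : R)
    (eps_bounds : 0 < eps < 1 / 16)
    (E_simple : simple_graph E)
    (w_gt0 : forall e, e \in E -> 0 < w e)
    (Mopt_max : max_weight_matching E w Mopt)
    (M_matching : matching E M)
    (M_light : weight w M < (1 - eps) * weight w Mopt
                          <= weight w Mopt / (1 + eps)) :
  exists CC : {set {set {set V}}},
    [/\ forall C, C \in CC -> augmentation E M C,
        forall C D, C \in CC -> D \in CC -> C != D ->
          [disjoint cover C & cover D],
        forall C, C \in CC ->
          exists i : int,
            [/\ 1 <= weight w C -> 0 <= i,
                (1 + eps ^+ 4) ^ i <= weight w C
              & augmentation_class E w M eps ((1 + eps ^+ 4) ^ i) C]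
      & eps ^+ 2 * weight w Mopt / 200 <= \sum_(C in CC) gain w M C].
Proof.
have [e0 _] := andP eps_bounds; have [Mopt_matching _] := Mopt_max.
have [ME _] := andP M_matching; have [NE _] := andP Mopt_matching.
have w_ge0 e : e \in E -> 0 <= w e by move/w_gt0/ltW.
have [L L0 [L_le budget]] := gain_budget eps_bounds.
have d0 : 0 <= eps ^+ 12 by rewrite exprn_ge0 ?ltW.
have [qs [qs_V qsP le_qs]] :=
  symdiff_pieces E_simple w_gt0 M_matching Mopt_matching L0 d0.
set F := _ :|: _ in qsP le_qs; set eta := _ + _ * eps ^+ 12 in budget le_qs.
pose pset (q : seq V) := [set e in path_edges q].
have FE : F \subset E by apply: symdiff_sub.
have qF q : q \in qs -> pset q \subset F.
  by case/qsP=> _ sub _; apply/subsetP => e; rewrite inE => /sub.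
have qs_uniq : uniq (flatten qs) by rewrite (perm_uniq qs_V) enum_uniq.
have q_uniq q : q \in qs -> uniq q by apply: uniq_mem_flatten.
(* A single vertex has no edges and is no augmentation; a piece of relatively small gain may fail
   the class after rounding. *)
pose good q := (1 < size q)%N && (eps ^+ 8 * weight w (pset q) <= gain w M (pset q)).
pose gs := [seq q <- qs | good q].
have gsP q : q \in gs -> [/\ q \in qs, (1 < size q)%N,
    cover (pset q) = [set x in q]
    & eps ^+ 8 * weight w (pset q) <= gain w M (pset q)].
  by rewrite mem_filter => /andP[/andP[sq gq] qqs]; rewrite /pset cover_path_edges.
have gs_meet q r x : q \in gs -> r \in gs ->
    x \in cover (pset q) -> x \in cover (pset r) -> q = r.
  move=> /gsP[qqs _ -> _] /gsP[rqs _ -> _]; rewrite !inE.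
  exact: mem_uniq_flatten qs_uniq qqs rqs.
(* Vertex sets of good pieces are nonempty and disjoint, so distinct pieces have distinct edge sets
   and passing to a set loses no summand. *)
have gs_uniq : uniq [seq pset q | q <- gs].
  rewrite map_inj_in_uniq => [|q r qg rg E'].
    apply: uniq_of_flatten; last by apply/negP => /gsP[].
    have /perm_flatten/perm_uniq := permEl (perm_filterC good qs).
    by rewrite qs_uniq flatten_cat cat_uniq => /andP[].
  have [x xq] : exists x, x \in cover (pset q).
    have [_ sq -> _] := gsP q qg.
    by case: q sq {qg E'} => // x q _; exists x; rewrite inE mem_head.
  by apply: (gs_meet q r x); rewrite -?E'.
have gs_aug q : q \in gs -> augmentation E M (pset q).
  move=> /gsP[qqs sq _ _]; left; have [_ sub _] := qsP q qqs.
  by apply: (symdiff_alternating_path M_matching Mopt_matching sq (q_uniq q qqs)); exact: sub.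
exists [set C in [seq pset q | q <- gs]]; split.
- by move=> C; rewrite inE => /mapP[q qg ->]; apply: gs_aug.
- move=> C D; rewrite !inE => /mapP[q qg ->] /mapP[r rg ->] qr.
  rewrite -setI_eq0; apply: contraNT qr => /set0Pn[x]; rewrite inE => /andP[xq xr].
  by rewrite (gs_meet q r x).
- move=> C; rewrite inE => /mapP[q qg ->]; have [qqs sq cq gq] := gsP q qg.
  have [size_q sub heavy] := qsP q qqs; have uq := q_uniq q qqs.
  have card_cover : #|cover (pset q)| = size q.
    by rewrite cq cardsE; apply/card_uniqP.
  have pqE : pset q \subset E by apply: subset_trans (qF q qqs) FE.
  apply: augmentation_in_class => //; first exact: gs_aug.
  + rewrite card_cover cardsE (leq_trans (card_size _)) //.
    by case: q {qg qqs sq cq gq size_q sub heavy uq card_cover pqE} => // x q;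
       rewrite /= size_pairmap.
  + rewrite -path_weight_set //; case: q sq pqE {qg qqs cq gq size_q sub heavy card_cover} uq.
      by [].
    move=> x [//|y q] _ /subsetP pqE _; rewrite /path_weight big_cons.
    rewrite ltr_pwDl ?w_gt0 ?pqE ?inE ?eqxx // big_seq sumr_ge0 // => e eq.
    by rewrite w_ge0 ?pqE // inE inE eq orbT.
  + by move=> e; rewrite inE -path_weight_set // => /heavy.
  rewrite card_cover; apply: le_trans (lerD L_le ler01).
  by rewrite addr0 ler_nat.
have -> : \sum_(C in [set C in [seq pset q | q <- gs]]) gain w M C =
    \sum_(q <- qs | good q) gain w M (pset q).
  transitivity (\sum_(C <- [seq pset q | q <- gs]) gain w M C).
    by rewrite big_uniq //=; apply: eq_bigl => C; rewrite inE.
  by rewrite big_map big_filter.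
have qs_weight : \sum_(q <- qs) weight w (pset q) <= 2 * weight w F.
  apply: (sum_weight_le E_simple w_gt0 M_matching Mopt_matching qs_V) => q qqs; split; first exact: qF.
  by move=> e; rewrite inE => /path_edge_sub.
have bad_gain : \sum_(q <- qs | ~~ good q) gain w M (pset q) <=
    eps ^+ 8 * \sum_(q <- qs) weight w (pset q).
  rewrite mulr_sumr [leRHS](bigID good) /= ler_wpDl //.
    rewrite big_seq_cond sumr_ge0 // => q /andP[/qF qFq _].
    rewrite mulr_ge0 ?exprn_ge0 ?(ltW e0) // sumr_ge0 // => e /(subsetP qFq).
    by move/(subsetP FE)/w_ge0.
  apply: ler_sum => q; rewrite negb_and -leqNgt -ltNge => /orP[sq|/ltW//].
  have -> : pset q = set0.
    by apply/setP => e; rewrite !inE; case: q sq => // x [].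
  by rewrite gain0 /weight big_set0 mulr0.
have wF : weight w F <= weight w M + weight w Mopt.
  rewrite [weight w F](big_setID M) lerD //; apply: weight_le => //.
  - exact: subsetIr.
  - by move=> e /(subsetP ME)/w_ge0.
  - by apply/subsetP => e; rewrite /F !inE; case: (e \in M); case: (e \in Mopt).
  by move=> e /(subsetP NE)/w_ge0.
have [lightM _] := andP M_light.
have wM0 : 0 <= weight w M by apply: sumr_ge0 => e /(subsetP ME)/w_ge0.
have wN0 : 0 <= weight w Mopt by apply: sumr_ge0 => e /(subsetP NE)/w_ge0.
have wFN : weight w F <= 2 * weight w Mopt.
  have : 0 <= eps * weight w Mopt by rewrite mulr_ge0 // ltW.
  by lra.
have eta0 : 0 <= eta by rewrite addr_ge0 // ?invr_ge0 // mulr_ge0.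
have e8 : 0 <= eps ^+ 8 by rewrite exprn_ge0 ?ltW.
(* The excess is more than [eps * w(Mopt)]. Cutting loses at most [4 eta w(F)], the dropped pieces
   at most [2 eps^8 w(F)]; with [w(F) <= 2 w(Mopt)] these are the coefficients in [budget]. *)
move: le_qs; rewrite (bigID good) /=.
have := ler_wpM2l eta0 wFN; have := ler_wpM2l e8 wFN.
have := ler_wpM2l e8 qs_weight; have := ler_wpM2r wN0 budget.
by move: bad_gain; lra.
Qed.
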